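(* Suppose the regularity conditions (R), the terminal conditions (T) and the open-loop stability condition (S) stated in the context hold, and let $\lambda>0$. Then the closed-loop system $$x(k+1)=f(x(k),\pi_{\mathrm{slack}}(x(k)))+w(k)$$ is input-to-state stable (ISS), and $V_{\mathrm{slack}}$ is a continuous ISS Lyapunov function for it.
   Context: Notation. $\|\cdot\|$ is the Euclidean norm; $\mathbb{I}_{[a,b]}$ (resp. $\mathbb{I}_{\ge a}$) is the set of integers in $[a,b]$ (resp. $\ge a$). $\mathcal{K}$: continuous strictly increasing functions $\alpha:\mathbb{R}_{\ge0}\to\mathbb{R}_{\ge0}$ with $\alpha(0)=0$; $\mathcal{K}_\infty$: radially unbounded functions in $\mathcal{K}$; $\mathcal{KL}$: functions $\beta:\mathbb{R}_{\ge0}\times\mathbb{I}_{\ge0}\to\mathbb{R}_{\ge0}$ with $\beta(\cdot,k)\in\mathcal{K}$ for each fixed $k$ and $\beta(r,\cdot)$ decreasing with limit $0$ for each fixed $r$. System. $x(k+1)=f(x(k),u(k))+w(k)$, $x(0)=x_0\in\mathbb{R}^n$, with inputs $u(k)\in\mathbb{U}\subseteq\mathbb{R}^m$ and arbitrary (unbounded) disturbances $w(k)\in\mathbb{R}^n$. $\ell:\mathbb{R}^n\times\mathbb{U}\to\mathbb{R}_{\ge0}$ is a stage cost and $\mathbb{X}\subseteq\mathbb{R}^n$ is a closed state constraint set. (R) Regularity: there is $\alpha_\ell\in\mathcal{K}_\infty$ with $\ell(x,u)\ge\alpha_\ell(\|x\|+\|u\|)$ for all $(x,u)\in\mathbb{R}^n\times\mathbb{U}$;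 $f(0,0)=0$, $\ell(0,0)=0$, $0\in\mathrm{int}(\mathbb{U})$, $0\in\mathrm{int}(\mathbb{X})$; $f,\ell$ are continuous; $\mathbb{U}$ is compact. Nominal MPC. Fix $N\in\mathbb{I}_{\ge1}$. For $x\in\mathbb{R}^n$ and $\mathbf{u}=(\mathbf{u}_0,\dots,\mathbf{u}_{N-1})\in\mathbb{U}^N$, $x_{\mathbf{u}}(k,x)$ is the state after $k$ steps of the undisturbed system ($w\equiv0$) started at $x_{\mathbf{u}}(0,x)=x$. Let $V_{\mathrm{f}}:\mathbb{R}^n\to\mathbb{R}_{\ge0}$ be continuous, $\mathbb{X}_{\mathrm{f}}\subseteq\mathbb{X}$ closed, and $$\mathcal{J}_N(x,\mathbf{u})=\sum_{k=0}^{N-1}\ell(x_{\mathbf{u}}(k,x),\mathbf{u}_k)+V_{\mathrm{f}}(x_{\mathbf{u}}(N,x)).$$ $\mathbb{X}_N\subseteq\mathbb{X}$ is the set of $x$ for which there is $\mathbf{u}\in\mathbb{U}^N$ with $x_{\mathbf{u}}(k,x)\in\mathbb{X}$ for $k\in\mathbb{I}_{[0,N-1]}$ and $x_{\mathbf{u}}(N,x)\in\mathbb{X}_{\mathrm{f}}$. (T) Terminal conditions: there are $k_{\mathrm{f}}:\mathbb{X}_{\mathrm{f}}\to\mathbb{U}$ and $\alpha_{\mathrm{f}}\in\mathcal{K}_\infty$ such that for every $x\in\mathbb{X}_{\mathrm{f}}$, with $u=k_{\mathrm{f}}(x)$, $x^+=f(x,u)$: $V_{\mathrm{f}}(x^+)\le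 V_{\mathrm{f}}(x)-\ell(x,u)$; $(x,u)\in\mathbb{X}\times\mathbb{U}$; $x^+\in\mathbb{X}_{\mathrm{f}}$; $V_{\mathrm{f}}(x)\le\alpha_{\mathrm{f}}(\|x\|)$. Moreover $0\in\mathrm{int}(\mathbb{X}_{\mathrm{f}})$ and $\mathbb{X}_N$ is compact. (S) Open-loop stability: $V_\delta:\mathbb{R}^n\times\mathbb{R}^n\to\mathbb{R}_{\ge0}$ is continuous and there are $\alpha_{\delta,1},\dots,\alpha_{\delta,4}\in\mathcal{K}_\infty$ such that for all $x,z,w\in\mathbb{R}^n$, $u\in\mathbb{U}$: $\alpha_{\delta,1}(\|x-z\|)\le V_\delta(x,z)\le\alpha_{\delta,2}(\|x-z\|)$ and $V_\delta(f(x,u)+w,f(z,u))-V_\delta(x,z)\le-\alpha_{\delta,3}(\|x-z\|)+\alpha_{\delta,4}(\|w\|)$. Relaxed MPC. For a weight $\lambda>0$, $$V_{\mathrm{slack}}(x)=\min_{\bar{x}\in\mathbb{R}^n,\,\mathbf{u}\in\mathbb{U}^N}\mathcal{J}_N(\bar{x},\mathbf{u})+\lambda V_\delta(x,\bar{x})\quad\text{s.t. }x_{\mathbf{u}}(k,\bar{x})\in\mathbb{X},\ k\in\mathbb{I}_{[0,N-1]},\ x_{\mathbf{u}}(N,\bar{x})\in\mathbb{X}_{\mathrm{f}},$$ with minimizer denoted $(\bar{x}^*_{\mathrm{slack}}(x),\mathbf{u}^*_{\mathrm{slack}}(x))$, and $\pi_{\mathrm{slack}}(x)=\mathbf{u}^*_{\mathrm{slack},0}(x)\in\mathbb{U}$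 is its first input. ISS. A system $x(k+1)=f_{\mathrm{cl}}(x(k),w(k))$ is ISS if there are $\beta\in\mathcal{KL}$, $\gamma\in\mathcal{K}$ such that for every $x(0)\in\mathbb{R}^n$, every sequence $w(k)\in\mathbb{R}^n$, and every $k\in\mathbb{I}_{\ge0}$: $\|x(k)\|\le\beta(\|x(0)\|,k)+\gamma\big(\max_{j\in\mathbb{I}_{[0,k-1]}}\|w(j)\|\big)$ (for $k=0$ the last term is $0$). A function $V:\mathbb{R}^n\to\mathbb{R}_{\ge0}$ is an ISS Lyapunov function for this system if there are $\tilde\alpha_1,\dots,\tilde\alpha_4\in\mathcal{K}_\infty$ with $\tilde\alpha_1(\|x\|)\le V(x)\le\tilde\alpha_2(\|x\|)$ and $V(f_{\mathrm{cl}}(x,w))-V(x)\le-\tilde\alpha_3(\|x\|)+\tilde\alpha_4(\|w\|)$ for all $x,w\in\mathbb{R}^n$. *)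

(* Defs.v *)
From HB Require Import structures.
From mathcomp Require Import all_boot all_order all_algebra.
From mathcomp Require Import all_classical all_reals all_analysis.

Set Implicit Arguments.
Unset Strict Implicit.
Unset Printing Implicit Defensive.

Import Order.TTheory GRing.Theory Num.Theory.
Import numFieldNormedType.Exports.

Local Open Scope classical_set_scope.
Local Open Scope ring_scope.

(* The library norm on row vectors is the sup norm; it induces the same
   topology, so only the quantitative estimates need the Euclidean norm. *)
Definition enorm (R : realType) (n : nat) (x : 'rV[R]_n) : R :=
  Num.sqrt (\sum_(i < n) x ord0 i ^+ 2).

(* Comparison functions live on [0, +oo[; their values at negative arguments
   are irrelevant. Nonnegativity on [0, +oo[ follows from alpha 0 = 0 and
   monotonicity. *)
Record classK (R : realType) (alpha : R -> R) : Prop := ClassK {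
  classK_continuous : {within `[0, +oo[, continuous alpha};
  classK_increasing :
    forall r s : R, 0 <= r -> r < s -> alpha r < alpha s;
  classK_0 : alpha 0 = 0 }.

Record classKinfty (R : realType) (alpha : R -> R) : Prop := ClassKinfty {
  classKinfty_classK : classK alpha;
  classKinfty_unbounded : alpha r @[r --> +oo] --> +oo }.

(* "Decreasing" in the second argument is nonstrict: beta 0 k = 0 for all k. *)
Record classKL (R : realType) (beta : R -> nat -> R) : Prop := ClassKL {
  classKL_classK : forall k : nat, classK (fun r => beta r k);
  classKL_decreasing : forall r : R, 0 <= r ->
    forall j k : nat, (j <= k)%N -> beta r k <= beta r j;
  classKL_cvg : forall r : R, 0 <= r -> beta r k @[k --> \oo] --> (0 : R) }.

Definition ISS (R : realType) (n : nat)
    (fcl : 'rV[R]_n -> 'rV[R]_n -> 'rV[R]_n) : Prop :=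
  exists (beta : R -> nat -> R) (gamma : R -> R),
    [/\ classKL beta, classK gamma &
        forall x w : nat -> 'rV[R]_n,
          (forall k, x k.+1 = fcl (x k) (w k)) ->
          forall k, enorm (x k) <= beta (enorm (x 0%N)) k
                      + gamma (\big[Num.max/0]_(j < k) enorm (w j))].

Definition ISS_Lyapunov (R : realType) (n : nat)
    (fcl : 'rV[R]_n -> 'rV[R]_n -> 'rV[R]_n) (V : 'rV[R]_n -> R) : Prop :=
  (forall x, 0 <= V x) /\
  exists alpha1 alpha2 alpha3 alpha4 : R -> R,
    [/\ [/\ classKinfty alpha1, classKinfty alpha2,
            classKinfty alpha3 & classKinfty alpha4],
        forall x, alpha1 (enorm x) <= V x <= alpha2 (enorm x) &
        forall x w, V (fcl x w) - V x
                      <= - alpha3 (enorm x) + alpha4 (enorm w)].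

Section MPC.
Variables (R : realType) (n m N : nat).

(* f and l are total, but their values outside R^n x U are never used. *)
Variables (f : 'rV[R]_n -> 'rV[R]_m -> 'rV[R]_n).
Variables (l : 'rV[R]_n -> 'rV[R]_m -> R).
Variables (X : set 'rV[R]_n) (U : set 'rV[R]_m).

Record regularity : Prop := Regularity {
  reg_stage_cost_lb : exists2 alpha_l : R -> R, classKinfty alpha_l &
    forall x u, U u -> alpha_l (enorm x + enorm u) <= l x u;
  reg_f0 : f 0 0 = 0;
  reg_l0 : l 0 0 = 0;
  reg_U0 : interior U 0;
  reg_X0 : interior X 0;
  reg_f_continuous : {within [set: 'rV[R]_n] `*` U,
    continuous (fun p : 'rV[R]_n * 'rV[R]_m => f p.1 p.2)};
  reg_l_continuous : {within [set: 'rV[R]_n] `*` U,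
    continuous (fun p : 'rV[R]_n * 'rV[R]_m => l p.1 p.2)};
  reg_U_compact : compact U }.

(* Undisturbed state after k steps; meaningful for k <= N. *)
Fixpoint traj (u : N.-tuple 'rV[R]_m) (k : nat) (x : 'rV[R]_n) : 'rV[R]_n :=
  if k is k'.+1 then f (traj u k' x) u`_k' else x.

Variables (Vf : 'rV[R]_n -> R) (Xf : set 'rV[R]_n).

Definition JN (x : 'rV[R]_n) (u : N.-tuple 'rV[R]_m) : R :=
  \sum_(k < N) l (traj u k x) u`_k + Vf (traj u N x).

Definition feasible (x : 'rV[R]_n) (u : N.-tuple 'rV[R]_m) : Prop :=
  [/\ forall k, (k < N)%N -> U u`_k,
      forall k, (k < N)%N -> X (traj u k x) &
      Xf (traj u N x)].

Definition XN : set 'rV[R]_n := [set x | exists u, feasible x u].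

Record terminal_conditions : Prop := TerminalConditions {
  term_controller :
    exists (kf : 'rV[R]_n -> 'rV[R]_m) (alpha_f : R -> R),
      classKinfty alpha_f /\
      forall x, Xf x ->
        [/\ Vf (f x (kf x)) <= Vf x - l x (kf x),
            X x /\ U (kf x),
            Xf (f x (kf x)) &
            Vf x <= alpha_f (enorm x)];
  term_Xf0 : interior Xf 0;
  term_XN_compact : compact XN }.

Variable Vdelta : 'rV[R]_n -> 'rV[R]_n -> R.

Record open_loop_stability : Prop := OpenLoopStability {
  ols_ge0 : forall x z, 0 <= Vdelta x z;
  ols_continuous :
    continuous (fun p : 'rV[R]_n * 'rV[R]_n => Vdelta p.1 p.2);
  ols_bounds : exists alpha1 alpha2 alpha3 alpha4 : R -> R,
    [/\ [/\ classKinfty alpha1, classKinfty alpha2,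
            classKinfty alpha3 & classKinfty alpha4],
        forall x z, alpha1 (enorm (x - z)) <= Vdelta x z
                      <= alpha2 (enorm (x - z)) &
        forall x z w u, U u ->
          Vdelta (f x u + w) (f z u) - Vdelta x z
            <= - alpha3 (enorm (x - z)) + alpha4 (enorm w)] }.

Variable lambda : R.

Definition slack_cost (x xbar : 'rV[R]_n) (u : N.-tuple 'rV[R]_m) : R :=
  JN xbar u + lambda * Vdelta x xbar.

Definition slack_minimizer (x xbar : 'rV[R]_n) (u : N.-tuple 'rV[R]_m) :
    Prop :=
  feasible xbar u /\
  forall z v, feasible z v -> slack_cost x xbar u <= slack_cost x z v.

(* The optimal value; it is a minimum whenever a [slack_minimizer] exists. *)
Definition Vslack (x : 'rV[R]_n) : R :=
  inf [set c | exists z v, feasible z v /\ c = slack_cost x z v].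

End MPC.

(* Main.v *)
Require Import Defs.
From HB Require Import structures.
From mathcomp Require Import all_boot all_order all_algebra.
From mathcomp Require Import all_classical all_reals all_analysis.
From mathcomp Require Import ring lra.
Import Order.TTheory GRing.Theory Num.Theory.
Import numFieldNormedType.Exports.
Local Open Scope classical_set_scope.
Local Open Scope ring_scope.

(** The optimal slack cost V is itself the ISS Lyapunov function, and every
    property of it comes from comparing the minimizer (z, u) at x with one
    well-chosen feasible candidate. Write a_l, d1, ..., d4 for the comparison
    functions of the stage cost and of the incremental Lyapunov function Vdelta.

    - Upper bound: the origin lies in the terminal set, where running the
      terminal controller is feasible and costs at most Vf 0 = 0
      ([terminal_feasible]). Choosing the origin as nominal state gives
      V x <= lambda * Vdelta x 0 <= lambda * d2 |x| for every x, because the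
      slack makes every state admissible.
    - Lower bound: V x >= a_l |z| + lambda * d1 |x - z|, and |x| / 2 is at most
      the larger of |z| and |x - z| ([min_half_le_add]).
    - Decrease: the nominal state is moved to f z u_0 with the shifted input
      sequence, the usual recursive-feasibility candidate ([shifted_feasible]);
      this lowers the nominal cost by at least l z u_0 >= a_l |z|. The
      real and the nominal state receive the same input u_0, so open-loop
      stability lowers Vdelta by d3 |x - z| up to d4 |w|. The two decreases
      combine as in the lower bound.

    Minimizers exist since feasible runs form a compact set: the triples of
    initial state, state after k steps and cost of these k steps are obtained
    from those for k - 1 by a continuous image of a compact set
    ([compact_reachable]), so no topology on input sequences is needed. V is
    continuous since x enters the cost through Vdelta x z only, and Vdelta is
    equicontinuous in x for z in the compact feasible set
    ([Vslack_continuous]).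

    An ISS Lyapunov function yields ISS ([ISS_Lyapunov_ISS]): along a
    trajectory y_k = V (x k) satisfies y_(k+1) <= y_k - a y_k + D with a of
    class K-infinity and D bounding the effect of the disturbance. While y_k
    exceeds the threshold inv(a) (2 D) it is contracted by a class-K map rho with
    rho s < s ([classK_contraction]); once below, it remains below
    inv(a) (2 D) + D ([comparison_principle]). The iterates of rho tend to 0,
    hence give the KL part. *)

(** * Comparison functions *)

Section Comparison.
Local Set Implicit Arguments.
Local Unset Strict Implicit.
Variable R : realType.
Implicit Types a b : R -> R.

(** Comparison functions carry no information on negative arguments, so
    continuity is used through this epsilon-delta form on the half-line. *)
Lemma within_ge0_continuousP (a : R -> R) :
  {within `[0, +oo[, continuous a} <->
  (forall x, 0 <= x -> forall e, 0 < e -> exists2 d, 0 < d &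
     forall y, 0 <= y -> `|x - y| < d -> `|a x - a y| < e).
Proof.
split=> [/subspace_continuousP ca x x0 e e0|ca].
  have /cvgrPdist_lt/(_ e e0) : a y @[y --> within `[0, +oo[ (nbhs x)] --> a x.
    by apply: ca; rewrite /= in_itv/= x0.
  rewrite near_withinE => /nbhs_ballP[d /= d0 hd].
  exists d => // y y0 xy; apply: hd => //=; first by rewrite in_itv/= y0.
apply/subspace_continuousP => x /=; rewrite in_itv/= andbT => x0.
apply/cvgrPdist_lt => e e0; have [d d0 hd] := ca x x0 e e0.
rewrite near_withinE; apply/nbhs_ballP; exists d => //= y xy.
by rewrite /= in_itv/= andbT => y0; apply: hd.
Qed.

Lemma classK_le a : classK a -> forall r s, 0 <= r -> r <= s -> a r <= a s.
Proof.
move=> ha r s r0; rewrite le_eqVlt => /predU1P[->//|rs].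
by apply/ltW/(classK_increasing ha).
Qed.

Lemma classK_ge0 a : classK a -> forall r, 0 <= r -> 0 <= a r.
Proof. by move=> ha r r0; rewrite -(classK_0 ha); apply: classK_le. Qed.

Lemma classK_lt_inv a : classK a ->
  forall r s, 0 <= r -> 0 <= s -> a r < a s -> r < s.
Proof.
move=> ha r s r0 s0; rewrite !ltNge; apply: contra => sr.
exact: (classK_le ha).
Qed.

Lemma classK_le_inv a : classK a ->
  forall r s, 0 <= r -> 0 <= s -> a r <= a s -> r <= s.
Proof.
move=> ha r s r0 s0; rewrite !leNgt; apply: contra => sr.
exact: (classK_increasing ha).
Qed.

Lemma classK_comp a b : classK a -> classK b -> classK (a \o b).
Proof.
move=> ha hb; split.
- have /within_ge0_continuousP ca := classK_continuous ha.
  have /within_ge0_continuousP cb := classK_continuous hb.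
  apply/within_ge0_continuousP => x x0 e e0.
  have [d d0 hd] := ca _ (classK_ge0 hb x0) e e0.
  have [c c0 hc] := cb _ x0 d d0.
  exists c => // y y0 xy /=; apply: hd; first exact: classK_ge0.
  exact: hc.
- move=> r s r0 rs /=; apply: (classK_increasing ha); first exact: classK_ge0.
  exact: (classK_increasing hb).
- by rewrite /= (classK_0 hb) (classK_0 ha).
Qed.

Lemma classK_id : classK (@id R).
Proof.
split => //; apply/within_ge0_continuousP => x x0 e e0.
by exists e.
Qed.

Lemma classK_add a b : classK a -> classK b -> classK (fun r => a r + b r).
Proof.
move=> ha hb; split.
- move=> x; apply: (@continuousD _ _ _ (a : subspace `[0, +oo[ -> R) b).
    exact: (classK_continuous ha).
  exact: (classK_continuous hb).
- move=> r s r0 rs; apply: ltrD; first exact: (classK_increasing ha).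
  exact: (classK_increasing hb).
- by rewrite (classK_0 ha) (classK_0 hb) addr0.
Qed.

Lemma classK_iter a : classK a -> forall k, classK (iter k a).
Proof.
move=> ha; elim=> [|k IHk]; first exact: classK_id.
exact: (classK_comp ha IHk).
Qed.

Lemma classKinfty_ge a : classKinfty a ->
  forall M, exists2 r, 0 <= r & M <= a r.
Proof.
move=> ha M; have /cvgryPge/(_ M) hM := classKinfty_unbounded ha.
have : \forall r \near +oo, 0 <= r /\ M <= a r.
  near=> r; split; near: r => //.
  by apply: nbhs_pinfty_ge; rewrite num_real.
by move=> /filter_ex[r [? ?]]; exists r.
Unshelve. all: by end_near. Qed.

Lemma classKinftyP a : classK a ->
  (forall M, exists2 r, 0 <= r & M <= a r) -> classKinfty a.
Proof.
move=> ha hu; split => //; apply/cvgryPge => M.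
have [r r0 Mr] := hu M; near=> s.
have rs : r <= s by near: s; apply: nbhs_pinfty_ge; rewrite num_real.
by apply: (le_trans Mr); apply: (classK_le ha).
Unshelve. all: by end_near. Qed.

Lemma classKinfty_surj a : classKinfty a ->
  forall y, 0 <= y -> exists2 x, 0 <= x & a x = y.
Proof.
move=> ha y y0; have hK := classKinfty_classK ha.
have [M M0 yM] := classKinfty_ge ha y.
have aM : a 0 <= a M by apply: (classK_le hK).
have cM : {within `[0, M], continuous a}.
  apply: (continuous_subspaceW _ (classK_continuous hK)).
  by apply: subset_itvl; rewrite bnd_simp.
have [|c] := IVT (v := y) M0 cM.
  by rewrite (min_idPl aM) (max_idPr aM) (classK_0 hK) y0 yM.
by rewrite in_itv/= => /andP[c0 _] <-; exists c.
Qed.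

(** An increasing bijection of the half-line is automatically continuous: the
    preimages of the endpoints of an interval around b x delimit a neighbourhood
    of x. This gives the continuity of inverses at no cost. *)
Lemma surj_increasing_classKinfty b : b 0 = 0 ->
  (forall r s, 0 <= r -> r < s -> b r < b s) ->
  (forall y, 0 <= y -> exists2 x, 0 <= x & b x = y) -> classKinfty b.
Proof.
move=> b0 binc bsurj.
have bnd r s : 0 <= r -> 0 <= s -> b r < b s -> r < s.
  move=> r0 s0; rewrite !ltNge; apply: contra.
  by rewrite le_eqVlt => /predU1P[->//|sr]; apply/ltW/binc.
have bge0 r : 0 <= r -> 0 <= b r.
  by rewrite le_eqVlt => /predU1P[<-|r0]; rewrite ?b0// -b0 ltW// binc.
apply: classKinftyP.
  split => //; apply/within_ge0_continuousP => x x0 e e0.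
  have [u u0 bu] : exists2 u, 0 <= u & b u = b x + e.
    by apply: bsurj; rewrite addr_ge0 ?bge0// ltW.
  have xu : x < u by apply: bnd => //; rewrite bu ltrDl.
  (* If b x - e is negative it has no preimage, but then the lower estimate
     follows from the nonnegativity of b. *)
  have [bxe|bxe] := leP 0 (b x - e).
    have [v v0 bv] := bsurj _ bxe.
    have vx : v < x by apply: bnd => //; rewrite bv ltrBlDr ltrDl.
    exists (Num.min (u - x) (x - v)); first by rewrite lt_min !subr_gt0 xu.
    move=> y y0; rewrite lt_min => /andP[]; rewrite !ltr_norml.
    move=> /andP[h1 _] /andP[_ h2].
    have : b y < b u by apply: binc => //; lra.
    have : b v < b y by apply: binc => //; lra.
    rewrite bu bv; lra.
  exists (u - x); rewrite ?subr_gt0// => y y0; rewrite !ltr_norml.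
  move=> /andP[h1 _].
  have : b y < b u by apply: binc => //; lra.
  have := bge0 _ y0; rewrite bu; lra.
move=> M; have [x x0 bx] : exists2 x, 0 <= x & b x = Num.max 0 M.
  by apply: bsurj; rewrite le_max lexx.
by exists x => //; rewrite bx le_max lexx orbT.
Qed.

Lemma classKinfty_inverse a : classKinfty a -> exists b, [/\ classKinfty b,
  (forall s, 0 <= s -> a (b s) = s) & (forall s, 0 <= s -> b (a s) = s)].
Proof.
move=> ha; have hK := classKinfty_classK ha.
have /choice[b hb] : forall y, exists x, 0 <= y -> 0 <= x /\ a x = y.
  move=> y; have [y0|_] := leP 0 y; last by exists 0.
  by have [x ? ?] := classKinfty_surj ha y0; exists x.
have bK s : 0 <= s -> b (a s) = s.
  move=> s0; have [b0 abs] := hb _ (classK_ge0 hK s0).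
  by apply/eqP; rewrite eq_le; apply/andP; split;
    apply: (classK_le_inv hK) => //; rewrite abs.
exists b; split => //; last by move=> s /hb[].
apply: surj_increasing_classKinfty.
- by rewrite -[in LHS](classK_0 hK) bK.
- move=> r s r0 rs; have [br abr] := hb _ r0.
  have [bs abs] := hb _ (le_trans r0 (ltW rs)).
  by apply: (classK_lt_inv hK) => //; rewrite abr abs.
- by move=> y y0; exists (a y); [exact: classK_ge0|exact: bK].
Qed.

Lemma classKinfty_comp a b :
  classKinfty a -> classKinfty b -> classKinfty (a \o b).
Proof.
move=> ha hb; have aK := classKinfty_classK ha.
have bK := classKinfty_classK hb.
apply: classKinftyP; first exact: classK_comp.
move=> M; have [r r0 Mr] := classKinfty_ge ha M.
have [s s0 rs] := classKinfty_ge hb r.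
by exists s => //=; apply: (le_trans Mr); apply: (classK_le aK).
Qed.

Lemma classKinfty_scale c : 0 < c -> classKinfty (fun r : R => c * r).
Proof.
move=> c0; apply: surj_increasing_classKinfty.
- by rewrite mulr0.
- by move=> r s _ rs; rewrite ltr_pM2l.
- move=> y y0; exists (c^-1 * y); first by rewrite mulr_ge0// invr_ge0 ltW.
  by rewrite mulrA mulfV ?mul1r// gt_eqF.
Qed.

Lemma classKinfty_min a b : classKinfty a -> classKinfty b ->
  classKinfty (fun r => Num.min (a r) (b r)).
Proof.
move=> ha hb; have aK := classKinfty_classK ha.
have bK := classKinfty_classK hb.
apply: classKinftyP; first split.
- have /within_ge0_continuousP ca := classK_continuous aK.
  have /within_ge0_continuousP cb := classK_continuous bK.
  apply/within_ge0_continuousP => x x0 e e0.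
  have [c c0 hc] := ca _ x0 _ e0; have [d d0 hd] := cb _ x0 _ e0.
  exists (Num.min c d); first by rewrite lt_min c0.
  move=> y y0; rewrite lt_min => /andP[/(hc _ y0) + /(hd _ y0)].
  rewrite !ltr_norml => /andP[? ?] /andP[? ?].
  by case: (leP (a x)); case: (leP (a y)) => ? ?; apply/andP; split; lra.
- move=> r s r0 rs; rewrite lt_min !gt_min.
  by rewrite (classK_increasing aK)// (classK_increasing bK)// orbT.
- by rewrite (classK_0 aK) (classK_0 bK) minxx.
- move=> M; have [r r0 Mr] := classKinfty_ge ha M.
  have [s s0 Ms] := classKinfty_ge hb M.
  exists (Num.max r s); first by rewrite le_max r0.
  rewrite le_min; apply/andP; split.
    by apply: (le_trans Mr); apply: (classK_le aK); rewrite // le_max lexx.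
  by apply: (le_trans Ms); apply: (classK_le bK); rewrite // le_max lexx orbT.
Qed.

(** The map s - a s need not be monotone. Its running supremum phi over [0, s] is
    monotone, and 1-Lipschitz because a is increasing; it stays below s since
    t - a t is at most s / 2 for t <= s / 2 and at most s - a (s / 2)
    afterwards. Averaging phi with the identity makes it strictly increasing. *)
Lemma classK_contraction a : classK a -> exists rho, [/\ classK rho,
  (forall s, 0 <= s -> s - a s <= rho s) & (forall s, 0 < s -> rho s < s)].
Proof.
move=> ha.
pose E s := [set t - a t | t in `[0, s]].
pose phi s := sup (E s).
have Eub s : ubound (E s) s.
  move=> y [t /=]; rewrite in_itv/= => /andP[t0 ts] <-.
  by have := classK_ge0 ha t0; lra.
have Ehas s : has_ubound (E s) by exists s; exact: Eub.
have phi_ge s t : 0 <= t -> t <= s -> t - a t <= phi s.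
  move=> t0 ts; apply: ub_le_sup; first exact: Ehas.
  by exists t => //=; rewrite in_itv/= t0.
have phi_le s c : 0 <= s ->
    (forall t, 0 <= t -> t <= s -> t - a t <= c) -> phi s <= c.
  move=> s0 h; apply: ge_sup; first by exists (0 - a 0), 0; rewrite //= in_itv/= lexx.
  by move=> y [t /=]; rewrite in_itv/= => /andP[? ?] <-; apply: h.
have phi_mono r s : 0 <= r -> r <= s -> phi r <= phi s.
  move=> r0 rs; apply: phi_le => // t t0 tr.
  by apply: phi_ge => //; apply: le_trans rs.
have phi_lip r s : 0 <= r -> r <= s -> phi s <= phi r + (s - r).
  move=> r0 rs; apply: phi_le => [|t t0 ts]; first exact: le_trans rs.
  have [tr|/ltW rt] := leP t r; first by have := phi_ge r t t0 tr; lra.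
  have := phi_ge r r r0 (lexx _); have := classK_le ha r0 rt; lra.
have phi_lt s : 0 < s -> phi s < s.
  move=> s0; have s20 : 0 <= s / 2 by lra.
  have as0 : 0 < a (s / 2).
    by rewrite -(classK_0 ha); apply: (classK_increasing ha) => //; lra.
  apply: (@le_lt_trans _ _ (Num.max (s / 2) (s - a (s / 2)))); last first.
    by rewrite gt_max; apply/andP; split; lra.
  apply: phi_le => [|t t0 ts]; first exact: ltW.
  rewrite le_max; have [ts2|/ltW st] := leP t (s / 2).
    by apply/orP; left; have := classK_ge0 ha t0; lra.
  by apply/orP; right; have := classK_le ha s20 st; lra.
have phi0 : phi 0 = 0.
  apply/eqP; rewrite eq_le; apply/andP; split.
    apply: phi_le => // t t0 t0'; have -> : t = 0 by apply/eqP; rewrite eq_le t0'.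
    by rewrite (classK_0 ha) subrr.
  by have := phi_ge 0 0 (lexx _) (lexx _); rewrite (classK_0 ha) subrr.
have dist r s : 0 <= r -> 0 <= s -> `|phi r - phi s| <= `|r - s|.
  wlog rs : r s / r <= s.
    move=> h r0 s0; have [rs|/ltW sr] := leP r s; first exact: h.
    by rewrite distrC (distrC r); apply: h.
  move=> r0 s0; have := phi_lip _ _ r0 rs; have := phi_mono _ _ r0 rs.
  move=> h1 h2; rewrite distrC (distrC r) !ger0_norm; lra.
have phiK : {within `[0, +oo[, continuous phi}.
  apply/within_ge0_continuousP => x x0 e e0; exists e => // y y0.
  by apply: le_lt_trans; apply: dist.
exists (fun s => 2^-1 * (phi s + s)); split.
- split.
  + apply/within_ge0_continuousP => x x0 e e0; exists e => // y y0.
    have := dist _ _ x0 y0; move=> h h'.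
    rewrite -mulrBr normrM ger0_norm ?invr_ge0 ?ler0n//.
    have : `|phi x + x - (phi y + y)| <= `|phi x - phi y| + `|x - y|.
      rewrite (_ : _ - _ = (phi x - phi y) + (x - y)); last ring.
      exact: ler_normD.
    lra.
  + move=> r s r0 rs; have := phi_mono r s r0 (ltW rs); lra.
  + by rewrite phi0 addr0 mulr0.
- move=> s s0; have := phi_ge s s s0 (lexx _); have := classK_ge0 ha s0; lra.
- move=> s s0; have := phi_lt _ s0; lra.
Qed.

End Comparison.

(** * From an ISS Lyapunov function to input-to-state stability *)

Section LyapunovISS.
Local Set Implicit Arguments.
Local Unset Strict Implicit.
Variable R : realType.

Lemma iter_contraction_ge0 (rho : R -> R) : classK rho ->
  forall r, 0 <= r -> forall k, 0 <= iter k rho r.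
Proof. by move=> hr r r0 k; apply: classK_ge0 => //; apply: classK_iter. Qed.

Lemma iter_contraction_le (rho : R -> R) : classK rho ->
  (forall s, 0 < s -> rho s < s) ->
  forall r, 0 <= r -> forall j k, (j <= k)%N -> iter k rho r <= iter j rho r.
Proof.
move=> hr rlt r r0 j k; elim: k => [|k IHk]; first by rewrite leqn0 => /eqP->.
rewrite leq_eqVlt => /predU1P[->//|/IHk]; apply: le_trans => /=.
have := iter_contraction_ge0 hr r0 k.
rewrite le_eqVlt => /predU1P[<-|/rlt/ltW//].
by rewrite (classK_0 hr).
Qed.

(** The iterates decrease to a limit L; by continuity rho L >= L, which forces
    L = 0. *)
Lemma iter_contraction_cvg0 (rho : R -> R) : classK rho ->
  (forall s, 0 < s -> rho s < s) ->
  forall r, 0 <= r -> iter k rho r @[k --> \oo] --> (0 : R).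
Proof.
move=> hr rlt r r0; set u := fun k => iter k rho r.
have u0 k : 0 <= u k by exact: iter_contraction_ge0.
have cu : cvgn u.
  apply: nonincreasing_is_cvgn.
    by move=> i j; apply: iter_contraction_le.
  by exists 0 => _ [k _ <-].
pose L := limn u; have uL : u @ \oo --> L by [].
have L0 : 0 <= L by apply: limr_ge => //; near=> k.
suff -> : 0 = L by [].
apply/eqP; rewrite eq_le L0/= leNgt; apply/negP => Lpos.
have Llt := rlt _ Lpos.
have /within_ge0_continuousP cr := classK_continuous hr.
have e0 : 0 < L - rho L by rewrite subr_gt0.
have [d d0 hd] := cr _ L0 _ e0.
have [k kd] : exists k, `|L - u k| < d.
  have /cvgrPdist_lt/(_ _ d0) := uL.
  by move=> /filter_ex.
have Lu : L <= u k.+1.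
  by apply: nonincreasing_cvgn_ge => // i j; apply: iter_contraction_le.
have := hd _ (u0 k) kd; rewrite distrC ltr_norml => /andP[_].
rewrite -[rho (u k)]/(u k.+1); lra.
Unshelve. all: by end_near. Qed.

(** Above the threshold b (2 D), at least half of the decrease a y survives the
    perturbation D, which leaves the map s - a s / 2, dominated by rho. Below it,
    one step increases y by at most D, so the level b (2 D) + D is never
    exceeded again. The bound K on time lets D depend on the
    disturbances up to a fixed time only. *)
Lemma comparison_principle (a b rho : R -> R) (D : R) (K : nat) (y : nat -> R) :
  classK a -> classK b -> (forall s, 0 <= s -> a (b s) = s) -> classK rho ->
  (forall s, 0 <= s -> s - 2^-1 * a s <= rho s) ->
  (forall s, 0 < s -> rho s < s) ->
  0 <= D -> (forall k, 0 <= y k) ->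
  (forall k, (k < K)%N -> y k.+1 <= y k - a (y k) + D) ->
  forall k, (k <= K)%N -> y k <= Num.max (iter k rho (y 0)) (b (2 * D) + D).
Proof.
move=> ha hb abK hr rge rlt D0 y0 ystep; elim=> [|k IHk] kK.
  by rewrite le_max lexx.
have {}IHk := IHk (ltnW kK); have yS := ystep _ kK.
have D20 : 0 <= 2 * D by lra.
have bD0 : 0 <= b (2 * D) + D by rewrite addr_ge0// (classK_ge0 hb).
have ay0 := classK_ge0 ha (y0 k).
have [yb|/ltW by_] := leP (y k) (b (2 * D)).
  by rewrite le_max; apply/orP; right; lra.
have : a (b (2 * D)) <= a (y k) by apply: classK_le => //; apply: classK_ge0.
rewrite abK// => Da.
have yrho : y k.+1 <= rho (y k) by have := rge _ (y0 k); lra.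
apply: (le_trans yrho); move: IHk; rewrite !le_max => /orP[h|h]; apply/orP.
  by left; apply: (classK_le hr).
right; apply: (@le_trans _ _ (rho (b (2 * D) + D))); first exact: (classK_le hr).
move: bD0; rewrite le_eqVlt => /predU1P[<-|/rlt/ltW//].
by rewrite (classK_0 hr).
Qed.

Lemma enorm_ge0 n (x : 'rV[R]_n) : 0 <= enorm x.
Proof. exact: sqrtr_ge0. Qed.

Lemma ISS_Lyapunov_ISS n (fcl : 'rV[R]_n -> 'rV[R]_n -> 'rV[R]_n) V :
  ISS_Lyapunov fcl V -> ISS fcl.
Proof.
move=> [V0 [a1 [a2 [a3 [a4 [[h1 h2 h3 h4] Vb Vd]]]]]].
have [k1 k2 k3 k4] := And4 (classKinfty_classK h1) (classKinfty_classK h2)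
  (classKinfty_classK h3) (classKinfty_classK h4).
have [i1 [/classKinfty_classK hi1 i1K i1K']] := classKinfty_inverse h1.
have [i2 [hi2 i2K i2K']] := classKinfty_inverse h2.
have ha := classKinfty_comp h3 hi2; set a := a3 \o i2 in ha.
have hi2K := classKinfty_classK hi2.
have aK := classKinfty_classK ha.
have [b [/classKinfty_classK hb abK _]] := classKinfty_inverse ha.
have ha2 : classK (fun s => 2^-1 * a s).
  have h : (0 : R) < 2^-1 by lra.
  exact: (classK_comp (classKinfty_classK (classKinfty_scale h)) aK).
have [rho [hrho rge rlt]] := classK_contraction ha2.
pose b2 s := b (2 * s) + s.
have hb2 : classK b2.
  apply: (@classK_add R (fun s => b (2 * s)) id); last exact: classK_id.
  have h : (0 : R) < 2 by lra.
  exact: (classK_comp hb (classKinfty_classK (classKinfty_scale h))).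
exists (fun r k => i1 (iter k rho (a2 r))), (i1 \o (b2 \o a4)); split.
- split.
  + move=> k; apply: (classK_comp hi1); apply: (classK_comp _ k2).
    exact: classK_iter.
  + move=> r r0 j k jk; have a20 := classK_ge0 k2 r0.
    apply: (classK_le hi1); first exact: iter_contraction_ge0.
    exact: iter_contraction_le.
  + move=> r r0; have a20 := classK_ge0 k2 r0.
    have /within_ge0_continuousP ci := classK_continuous hi1.
    apply/cvgrPdist_lt => e e0; have [d d0 hd] := ci 0 (lexx _) _ e0.
    have /cvgrPdist_lt/(_ _ d0) := iter_contraction_cvg0 hrho rlt a20.
    apply: filterS => k kd; rewrite -(classK_0 hi1); apply: hd => //.
    exact: iter_contraction_ge0.
- by apply: (classK_comp hi1); apply: (classK_comp hb2).
move=> x w xS k; set W := \big[Num.max/0]_(j < k) _.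
have W0 : 0 <= W by apply: bigmax_ge_id.
have wW j : (j < k)%N -> enorm (w j) <= W.
  by move=> jk; apply: (le_bigmax _ (fun j : 'I_k => enorm (w j)) (Ordinal jk)).
have step j : (j < k)%N ->
    V (x j.+1) <= V (x j) - a (V (x j)) + a4 W.
  move=> jk; have := Vd (x j) (w j); rewrite -xS.
  have : a4 (enorm (w j)) <= a4 W.
    by apply: (classK_le k4); [exact: enorm_ge0|exact: wW].
  have /andP[_ Va2] := Vb (x j).
  have : a (V (x j)) <= a3 (enorm (x j)).
    apply: (classK_le k3); first exact: (classK_ge0 hi2K).
    by rewrite -(i2K' (enorm (x j)) (enorm_ge0 _)); apply: (classK_le hi2K).
  lra.
have D0 : 0 <= a4 W by apply: classK_ge0.
have := comparison_principle aK hb abK hrho rge rlt D0 (fun j => V0 (x j)) step (leqnn k).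
rewrite -/(b2 _) => hV.
have [/andP[_ Vx0] /andP[Vxk _]] := (Vb (x 0%N), Vb (x k)).
have it0 := iter_contraction_ge0 hrho (classK_ge0 k2 (enorm_ge0 (x 0%N))) k.
have it_le : iter k rho (V (x 0%N)) <= iter k rho (a2 (enorm (x 0%N))).
  by apply: classK_le => //; apply: classK_iter.
have xi : enorm (x k) <= i1 (V (x k)).
  rewrite -(i1K' (enorm (x k)) (enorm_ge0 _)); apply: (classK_le hi1) => //.
  by apply: classK_ge0 => //; apply: enorm_ge0.
have bW0 : 0 <= b2 (a4 W) by apply: classK_ge0.
have g1 := classK_ge0 hi1 bW0; have g2 := classK_ge0 hi1 it0.
apply: (le_trans xi) => /=; move: hV; rewrite le_max => /orP[h|h].
  have : i1 (V (x k)) <= i1 (iter k rho (a2 (enorm (x 0%N)))).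
    by apply: (classK_le hi1) => //; apply: le_trans it_le.
  lra.
have : i1 (V (x k)) <= i1 (b2 (a4 W)) by apply: (classK_le hi1).
lra.
Qed.

End LyapunovISS.

(** * Splitting the Euclidean norm *)

Section EuclideanNorm.
Local Set Implicit Arguments.
Local Unset Strict Implicit.
Variables (R : realType) (n : nat).
Implicit Types x z : 'rV[R]_n.

Lemma enorm0 : enorm (0 : 'rV[R]_n) = 0.
Proof.
by rewrite /enorm big1 ?sqrtr0// => i _; rewrite mxE expr0n.
Qed.

(** Follows coordinatewise from the parallelogram bound
    x^2 <= 2 z^2 + 2 (x - z)^2, which avoids the triangle inequality. *)
Lemma enorm_half_le_max x z :
  2^-1 * enorm x <= Num.max (enorm z) (enorm (x - z)).
Proof.
set M := Num.max _ _.
have zM : enorm z <= M by rewrite le_max lexx.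
have yM : enorm (x - z) <= M by rewrite le_max lexx orbT.
have M0 : 0 <= M by apply: le_trans zM; exact: enorm_ge0.
have sqE y : enorm y ^+ 2 = \sum_(i < n) (y : 'rV[R]_n) ord0 i ^+ 2.
  by rewrite /enorm sqr_sqrtr// sumr_ge0// => i _; exact: sqr_ge0.
suff : enorm x <= 2 * M by lra.
rewrite -ler_sqr ?nnegrE ?enorm_ge0//; last by lra.
have : enorm x ^+ 2 <= 2 * enorm z ^+ 2 + 2 * enorm (x - z) ^+ 2.
  rewrite !sqE !mulr_sumr -big_split/=; apply: ler_sum => i _.
  rewrite !mxE -subr_ge0.
  have := sqr_ge0 (x ord0 i - 2 * z ord0 i).
  by congr (0 <= _); ring.
have : enorm z ^+ 2 <= M ^+ 2 by rewrite ler_sqr ?nnegrE ?enorm_ge0.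
have : enorm (x - z) ^+ 2 <= M ^+ 2 by rewrite ler_sqr ?nnegrE ?enorm_ge0.
rewrite exprMn; lra.
Qed.

(** Turns separate estimates on the nominal state z and on the slack x - z into
    one on the real state x. *)
Lemma min_half_le_add (a b : R -> R) : classK a -> classK b ->
  forall x z, Num.min (a (2^-1 * enorm x)) (b (2^-1 * enorm x)) <=
    a (enorm z) + b (enorm (x - z)).
Proof.
move=> ha hb x z; have h0 : 0 <= 2^-1 * enorm x.
  by rewrite mulr_ge0 ?invr_ge0// enorm_ge0.
have az := classK_ge0 ha (enorm_ge0 z).
have bz := classK_ge0 hb (enorm_ge0 (x - z)).
have := enorm_half_le_max x z; rewrite le_max ge_min => /orP[h|h].
  by have := classK_le ha h0 h => ?; apply/orP; left; lra.
by have := classK_le hb h0 h => ?; apply/orP; right; lra.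
Qed.

Lemma classKinfty_min_half (a b : R -> R) : classKinfty a -> classKinfty b ->
  classKinfty (fun r => Num.min (a (2^-1 * r)) (b (2^-1 * r))).
Proof.
have h : classKinfty (fun r : R => 2^-1 * r) by apply: classKinfty_scale; lra.
by move=> ha hb; apply: (@classKinfty_min R (a \o _) (b \o _));
  apply: classKinfty_comp.
Qed.

End EuclideanNorm.

(** * Continuity of pairs and projections *)

Lemma cvg_to_pair {T : Type} {A B : topologicalType} {F : set_system T}
    {FF : Filter F} {g : T -> A} {h : T -> B} {a : A} {b : B} :
  g x @[x --> F] --> a -> h x @[x --> F] --> b ->
  (g x, h x) @[x --> F] --> (a, b).
Proof. exact: cvg_pair. Qed.

Lemma fst_continuous (A B : topologicalType) :
  continuous (fst : A * B -> A).
Proof. by move=> [a b]; exact: cvg_fst. Qed.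

Lemma snd_continuous (A B : topologicalType) :
  continuous (snd : A * B -> B).
Proof. by move=> [a b]; exact: cvg_snd. Qed.

Lemma fst_fst_continuous (A B C : topologicalType) (p : A * B * C) :
  {for p, continuous (fun p => p.1.1)}.
Proof. by apply: continuous_comp; exact: fst_continuous. Qed.

Lemma fst_snd_continuous (A B C : topologicalType) (p : A * B * C) :
  {for p, continuous (fun p => p.1.2)}.
Proof.
by apply: continuous_comp; [exact: fst_continuous|exact: snd_continuous].
Qed.

Lemma closed_fst_snd (A B C : topologicalType) (D : set B) :
  closed D -> closed [set p : A * B * C | D p.1.2].
Proof.
move=> D_closed; apply: (preimage_closed _ D_closed) => p _.
exact: fst_snd_continuous.
Qed.

(** * Compactness of the feasible runs *)

Section RecedingHorizon.
Local Set Implicit Arguments.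
Local Unset Strict Implicit.
Variables (R : realType) (n m N : nat).
Variables (f : 'rV[R]_n -> 'rV[R]_m -> 'rV[R]_n).
Variables (l : 'rV[R]_n -> 'rV[R]_m -> R).
Variables (X : set 'rV[R]_n) (U : set 'rV[R]_m).
Variables (Vf : 'rV[R]_n -> R) (Xf : set 'rV[R]_n).

Lemma eq_traj (u v : N.-tuple 'rV[R]_m) k x :
  (forall j, (j < k)%N -> u`_j = v`_j) -> traj f u k x = traj f v k x.
Proof.
elim: k => //= k IHk uv; rewrite uv// IHk// => j jk.
exact/uv/ltnW.
Qed.

Lemma nth_input_tuple (v : nat -> 'rV[R]_m) i : (i < N)%N ->
  [tuple v j | j < N]`_i = v i.
Proof. by move=> iN; rewrite -[i]/(val (Ordinal iN)) nth_mktuple. Qed.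

Definition prefix_cost (u : N.-tuple 'rV[R]_m) k x : R :=
  \sum_(j < k) l (traj f u j x) u`_j.

(** The triples (initial state in Z, state after k steps, cost of these steps)
    over all runs whose inputs and first k states satisfy the constraints. The
    step from k - 1 to k is the image of a product under a continuous map, which
    is what makes compactness an induction on k; the initial state is carried
    along because the slack term depends on it. *)
Fixpoint reachable (Z : set 'rV[R]_n) (k : nat) :
    set ('rV[R]_n * 'rV[R]_n * R) :=
  if k is k'.+1 then
    (fun p => (p.1.1.1, f p.1.1.2 p.2, p.1.2 + l p.1.1.2 p.2)) @`
      ((reachable Z k' `&` [set p | X p.1.2]) `*` U)
  else (fun z => (z, z, 0)) @` Z.

Lemma reachable_sound Z k p : (k <= N)%N -> reachable Z k p ->
  exists2 u : N.-tuple 'rV[R]_m,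
    Z p.1.1 /\ p = (p.1.1, traj f u k p.1.1, prefix_cost u k p.1.1) &
    forall j, (j < k)%N -> U u`_j /\ X (traj f u j p.1.1).
Proof.
elim: k p => [|k IHk] p kN /=.
  move=> [z Zz <-]; exists [tuple 0 | j < N] => //=; split => //.
  by rewrite /prefix_cost big_ord0.
move=> [[q w] /= [[/(IHk _ (ltnW kN))[u [Zq qE] hu] Xq] Uw] <-] /=.
(* The state after k steps depends on the inputs before k only, so the input
   at k can be overwritten. *)
pose v j := if j == k then w else u`_j.
have vE j : (j < k)%N -> [tuple v j | j < N]`_j = u`_j.
  move=> jk; rewrite nth_input_tuple /v ?(ltn_eqF jk)//.
  exact: ltn_trans kN.
have vk : [tuple v j | j < N]`_k = w by rewrite nth_input_tuple// /v eqxx.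
have tE j : (j <= k)%N ->
    traj f [tuple v j | j < N] j q.1.1 = traj f u j q.1.1.
  by move=> jk; apply: eq_traj => i ij; apply: vE; apply: leq_trans jk.
exists [tuple v j | j < N].
  split=> //; rewrite /= /prefix_cost big_ord_recr/= vk tE//.
  rewrite (eq_bigr (fun j : 'I_k => l (traj f u j q.1.1) u`_j)).
    by rewrite -/(prefix_cost u k q.1.1) qE.
  by move=> j _; rewrite tE ?vE// ltnW.
move=> j; rewrite ltnS leq_eqVlt => /predU1P[->|jk].
  by rewrite vk tE//; split => //; move: Xq; rewrite /= {1}qE.
by rewrite vE// tE ?(ltnW jk)//; exact: hu.
Qed.

Lemma reachable_complete Z k x (u : N.-tuple 'rV[R]_m) : (k <= N)%N ->
  Z x -> (forall j, (j < k)%N -> U u`_j /\ X (traj f u j x)) ->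
  reachable Z k (x, traj f u k x, prefix_cost u k x).
Proof.
move=> + Zx; elim: k => [|k IHk] kN hu /=.
  by exists x => //; rewrite /prefix_cost big_ord0.
have [Uk Xk] := hu _ (ltnSn k).
exists ((x, traj f u k x, prefix_cost u k x), u`_k) => /=.
  split => //; split => //; apply: IHk; first exact: ltnW.
  by move=> j jk; apply/hu/ltnW.
by rewrite /prefix_cost big_ord_recr.
Qed.

Hypothesis X_closed : closed X.
Hypothesis U_compact : compact U.
Hypothesis f_continuous : {within [set: 'rV[R]_n] `*` U,
  continuous (fun p : 'rV[R]_n * 'rV[R]_m => f p.1 p.2)}.
Hypothesis l_continuous : {within [set: 'rV[R]_n] `*` U,
  continuous (fun p : 'rV[R]_n * 'rV[R]_m => l p.1 p.2)}.

(** f and l are continuous on the set of pairs with second component in U only;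
    the factor U of the domain keeps the image within that set. *)
Lemma compact_reachable Z k : compact Z -> compact (reachable Z k).
Proof.
move=> cZ; elim: k => [|k IHk] /=.
  have c0 : continuous (fun z : 'rV[R]_n => (z, z, 0 : R)).
    move=> z; apply: (@cvg_to_pair _ _ _ _ (nbhs_filter z) (fun z => (z, z))).
      by apply: (@cvg_to_pair _ _ _ _ (nbhs_filter z) id id); exact: cvg_id.
    exact: cvg_cst.
  by apply: continuous_compact => //; apply: continuous_subspaceT.
apply: continuous_compact; last first.
  apply: compact_setX => //; apply: compact_closedI => //.
  exact: closed_fst_snd.
apply/subspace_continuousP => -[[[z x] c] w] /= [[_ _] Uw].
set A := (X in within X _).
pose T := ('rV[R]_n * 'rV[R]_n * R * 'rV[R]_m)%type.
pose g (p : T) := (p.1.1.2, p.2).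
pose q0 : T := (z, x, c, w).
have gA : g p @[p --> within A (nbhs q0)] -->
    within ([set: 'rV[R]_n] `*` U) (nbhs (x, w)).
  have gc : {for q0, continuous g}.
    apply: cvg_to_pair; last exact: snd_continuous.
    by apply: (@continuous_comp _ _ _ fst (fun p => p.1.2));
      [exact: fst_continuous|exact: fst_snd_continuous].
  move=> B; rewrite /within/= => /gc; rewrite /nbhs/=.
  by apply: filterS => p hp [_ Up]; apply: hp.
have hf : f (g p).1 (g p).2 @[p --> within A (nbhs q0)] --> f x w.
  apply: (@cvg_comp _ _ _ g (fun p => f p.1 p.2) _ _ _ gA).
  by move/subspace_continuousP : f_continuous => /(_ (x, w)); apply.
have hl : l (g p).1 (g p).2 @[p --> within A (nbhs q0)] --> l x w.
  apply: (@cvg_comp _ _ _ g (fun p => l p.1 p.2) _ _ _ gA).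
  by move/subspace_continuousP : l_continuous => /(_ (x, w)); apply.
apply: cvg_to_pair; first apply: cvg_to_pair => //.
- apply: cvg_within_filter.
  by apply: (@continuous_comp _ _ _ fst (fun p => p.1.1));
    [exact: fst_continuous|exact: fst_fst_continuous].
- apply: cvgD => //; apply: cvg_within_filter.
  by apply: (@continuous_comp _ _ _ fst snd);
    [exact: fst_continuous|exact: snd_continuous].
Qed.

Lemma JN_prefix_cost x (u : N.-tuple 'rV[R]_m) :
  JN f l Vf x u = prefix_cost u N x + Vf (traj f u N x).
Proof. by []. Qed.

(** * The optimal slack cost *)

Section Optimum.
Variables (Vdelta : 'rV[R]_n -> 'rV[R]_n -> R) (lambda : R).

Notation feas := (feasible f X U Xf).
Notation cost := (slack_cost f l Vf Vdelta lambda).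
Notation minimizer := (slack_minimizer f l X U Vf Xf Vdelta lambda).
Notation V := (Vslack N f l X U Vf Xf Vdelta lambda).

(** The cost of a run depends on its reachable triple only, continuously, so it
    attains its minimum over the compact set of triples of feasible runs. *)
Lemma slack_minimizer_exists : closed Xf -> continuous Vf ->
  compact (XN N f X U Xf) ->
  continuous (fun p : 'rV[R]_n * 'rV[R]_n => Vdelta p.1 p.2) ->
  (exists z (u : N.-tuple 'rV[R]_m), feas z u) ->
  forall x, exists z (u : N.-tuple 'rV[R]_m), minimizer x z u.
Proof.
move=> Xf_closed Vfc XNc Vdc [z0 [u0 fu0]] x.
pose A := reachable (XN N f X U Xf) N `&` [set p | Xf p.1.2].
pose F (p : 'rV[R]_n * 'rV[R]_n * R) := p.2 + Vf p.1.2 + lambda * Vdelta x p.1.1.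
have feasA z (u : N.-tuple 'rV[R]_m) : feas z u ->
    A (z, traj f u N z, prefix_cost u N z).
  move=> fzu; have [hU hX hXf] := fzu; split => //.
  apply: reachable_complete => //; first by exists u.
  by move=> j jN; split; [exact: hU|exact: hX].
have cA : compact A.
  apply: compact_closedI; first exact: compact_reachable.
  exact: closed_fst_snd.
have cF : continuous F.
  move=> p; apply: cvgD; first apply: cvgD.
  - exact: snd_continuous.
  - by apply: (@continuous_comp _ _ _ (fun p => p.1.2) Vf); [exact: fst_snd_continuous|exact: Vfc].
  apply: cvgM; first exact: cvg_cst.
  apply: (@continuous_comp _ _ _ (fun p => (x, p.1.1)) (fun p => Vdelta p.1 p.2)).
    apply: (@cvg_to_pair _ _ _ _ (nbhs_filter p) (fun=> x)); first exact: cvg_cst.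
    exact: fst_fst_continuous.
  exact: Vdc.
have A0 : A !=set0 by eexists; exact: (feasA _ _ fu0).
have [q /set_mem[qr qXf] qmin] := compact_EVT_min A0 cA
  (continuous_subspaceT cF).
have [u [qZ qE] qu] := reachable_sound (leqnn N) qr.
exists q.1.1, u; split.
  split; [by move=> k /qu[]|by move=> k /qu[]|].
  by move: qXf; rewrite /= qE.
move=> z v /feasA/mem_set/qmin.
by rewrite /F /slack_cost !JN_prefix_cost qE.
Qed.

Hypothesis cost_ge0 : forall x z (u : N.-tuple 'rV[R]_m),
  feas z u -> 0 <= cost x z u.

Lemma Vslack_le x z (u : N.-tuple 'rV[R]_m) : feas z u -> V x <= cost x z u.
Proof.
move=> fzu; apply: ge_inf; last by exists z, u.
by exists 0 => _ [z' [u' [h ->]]]; exact: cost_ge0.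
Qed.

Lemma Vslack_minimizer x z (u : N.-tuple 'rV[R]_m) :
  minimizer x z u -> V x = cost x z u.
Proof.
move=> [fzu umin]; apply/eqP; rewrite eq_le Vslack_le//=.
apply: lb_le_inf; first by eexists; exists z, u.
by move=> _ [z' [u' [h ->]]]; exact: umin.
Qed.

(** The minimizer at x is feasible for every y, since the constraints bear on the
    nominal state only; hence V y - V x <= lambda (Vdelta y z - Vdelta x z), and
    symmetrically. As the nominal state z ranges over a compact set, this
    difference is uniformly small for y near x. *)
Lemma Vslack_continuous : 0 < lambda -> compact (XN N f X U Xf) ->
  continuous (fun p : 'rV[R]_n * 'rV[R]_n => Vdelta p.1 p.2) ->
  (forall x, exists z (u : N.-tuple 'rV[R]_m), minimizer x z u) ->
  continuous V.
Proof.
move=> lambda0 XNc Vdc hmin x.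
apply/(@cvgrPdist_lt _ _ _ _ (nbhs_filter x)) => e e0.
have el0 : 0 < e / lambda by rewrite divr_gt0.
have : \forall y \near x, XN N f X U Xf `<=`
    [set z | `|Vdelta x z - Vdelta y z| < e / lambda].
  apply: (iffLR (compact_near_coveringP _) XNc _ _
    (fun y z => `|Vdelta x z - Vdelta y z| < e / lambda) (nbhs_filter x)) => z _.
  pose D (p : 'rV[R]_n * 'rV[R]_n) := Vdelta x p.1 - Vdelta p.2 p.1.
  have cD : {for (z, x), continuous D}.
    apply: cvgB.
      apply: (@continuous_comp _ _ _ (fun p => (x, p.1)) (fun p => Vdelta p.1 p.2)).
        apply: (@cvg_to_pair _ _ _ _ (nbhs_filter (z, x)) (fun=> x)).
          exact: cvg_cst.
        exact: fst_continuous.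
      exact: Vdc.
    apply: (@continuous_comp _ _ _ (fun p => (p.2, p.1)) (fun p => Vdelta p.1 p.2)).
      apply: (@cvg_to_pair _ _ _ _ (nbhs_filter (z, x)) snd fst).
        exact: snd_continuous.
      exact: fst_continuous.
    exact: Vdc.
  have /cvgrPdist_lt/(_ _ el0) := cD; apply: filterS => -[z' y] /=.
  by rewrite /D /= subrr sub0r normrN.
apply: filterS => y hy.
have key x1 x2 : (forall z, XN N f X U Xf z ->
    `|Vdelta x1 z - Vdelta x2 z| < e / lambda) -> V x2 - V x1 < e.
  move=> h; have [z [u hu]] := hmin x1; have [fzu _] := hu.
  have := Vslack_le x2 fzu; rewrite (Vslack_minimizer hu) /slack_cost.
  have /h : XN N f X U Xf z by exists u.
  rewrite distrC => /(le_lt_trans (ler_norm _)).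
  rewrite ltr_pdivlMr// mulrBl !(mulrC _ lambda); lra.
rewrite ltr_norml; apply/andP; split.
  by have := key x y hy; lra.
by apply: key => z /hy; rewrite distrC.
Qed.

End Optimum.

(** * Candidate inputs from the terminal controller *)

Variables (kf : 'rV[R]_n -> 'rV[R]_m).
Hypothesis Xf_sub : Xf `<=` X.
Hypothesis kf_U : forall x, Xf x -> U (kf x).
Hypothesis kf_Xf : forall x, Xf x -> Xf (f x (kf x)).
Hypothesis kf_decr : forall x, Xf x -> Vf (f x (kf x)) <= Vf x - l x (kf x).

(** The inputs of the terminal controller: the decrease of Vf pays for each stage
    cost, so the sum telescopes. *)
Lemma terminal_feasible z : Xf z ->
  exists2 u : N.-tuple 'rV[R]_m, feasible f X U Xf z u & JN f l Vf z u <= Vf z.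
Proof.
move=> Xz; pose s k := iter k (fun x => f x (kf x)) z.
pose u := [tuple kf (s j) | j < N].
have sX k : Xf (s k) by elim: k => //= k IHk; apply: kf_Xf.
have uE k : (k < N)%N -> u`_k = kf (s k).
  by move=> kN; rewrite (nth_input_tuple (fun j => kf (s j))).
have tE k : (k <= N)%N -> traj f u k z = s k.
  by elim: k => //= k IHk kN; rewrite uE// IHk// ltnW.
exists u.
  split => [k kN|k kN|]; first by rewrite uE//; exact: kf_U.
    by rewrite tE ?(ltnW kN)//; exact/Xf_sub.
  by rewrite tE.
rewrite JN_prefix_cost.
suff H k : (k <= N)%N -> prefix_cost u k z + Vf (traj f u k z) <= Vf z by exact: H.
elim: k => [|k IHk] kN; first by rewrite /prefix_cost big_ord0 add0r.
rewrite /prefix_cost big_ord_recr -/(prefix_cost _ _ _) /=.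
have := IHk (ltnW kN); rewrite uE// !tE ?(ltnW kN)//.
by have := kf_decr (sX k); lra.
Qed.

(** Drop the first input and append one step of the terminal controller: the
    appended stage cost is paid for by the decrease of Vf, so at least the first
    stage cost is saved. *)
Lemma shifted_feasible z (u : N.-tuple 'rV[R]_m) : (1 <= N)%N ->
  feasible f X U Xf z u ->
  exists2 v : N.-tuple 'rV[R]_m, feasible f X U Xf (f z u`_0) v &
    JN f l Vf (f z u`_0) v <= JN f l Vf z u - l z u`_0.
Proof.
move=> N0 [hU hX hXf]; set xN := traj f u N z in hXf.
pose w j := if (j.+1 < N)%N then u`_j.+1 else kf xN.
pose v := [tuple w j | j < N].
have vE j : (j.+1 < N)%N -> v`_j = u`_j.+1.
  by move=> jN; rewrite /v nth_input_tuple ?(ltnW jN)// /w jN.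
have vL : v`_N.-1 = kf xN.
  by rewrite /v nth_input_tuple ?prednK// /w prednK// ltnn.
have tE k : (k < N)%N -> traj f v k (f z u`_0) = traj f u k.+1 z.
  elim: k => //= k IHk kN; rewrite IHk ?(ltnW kN)// vE//.
have tP : traj f v N.-1 (f z u`_0) = xN by rewrite tE ?prednK.
have tL : traj f v N (f z u`_0) = f xN (kf xN).
  by rewrite -[X in traj f v X](prednK N0) /= tP vL.
exists v; first split.
- move=> k; rewrite -{1}(prednK N0) ltnS leq_eqVlt => /predU1P[->|kN].
    by rewrite vL; exact: kf_U.
  by rewrite vE -?ltn_predRL//; apply: hU; rewrite -ltn_predRL.
- move=> k; rewrite -{1}(prednK N0) ltnS leq_eqVlt => /predU1P[->|kN].
    by rewrite tP; exact: Xf_sub.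
  rewrite tE; last by rewrite (leq_trans kN)// leq_pred.
  by apply: hX; rewrite -ltn_predRL.
- by rewrite tL; exact: kf_Xf.
rewrite /JN tL -/xN.
have -> : \sum_(k < N) l (traj f v k (f z u`_0)) v`_k =
    \sum_(k < N.-1) l (traj f u k.+1 z) u`_k.+1 + l xN (kf xN).
  rewrite -(big_mkord xpredT (fun k => l (traj f v k (f z u`_0)) v`_k)).
  rewrite -{1}(prednK N0) big_mkord big_ord_recr /= tP vL; congr (_ + _).
  apply: eq_bigr => -[k /= kN] _; rewrite tE ?vE -?ltn_predRL//.
  by rewrite (leq_trans kN)// leq_pred.
have -> : \sum_(k < N) l (traj f u k z) u`_k =
    l z u`_0 + \sum_(k < N.-1) l (traj f u k.+1 z) u`_k.+1.
  rewrite -(big_mkord xpredT (fun k => l (traj f u k z) u`_k)).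
  by rewrite -{1}(prednK N0) big_mkord big_ord_recl.
by have := kf_decr hXf; lra.
Qed.

End RecedingHorizon.

(** * Stability of the relaxed scheme *)

Theorem theorem1 (R : realType) (n m N : nat) (hN : (1 <= N)%N)
  (f : 'rV[R]_n -> 'rV[R]_m -> 'rV[R]_n)
  (l : 'rV[R]_n -> 'rV[R]_m -> R)
  (X : set 'rV[R]_n) (U : set 'rV[R]_m)
  (Vf : 'rV[R]_n -> R) (Xf : set 'rV[R]_n)
  (Vdelta : 'rV[R]_n -> 'rV[R]_n -> R) (lambda : R)
  (l_ge0 : forall x u, U u -> 0 <= l x u)
  (X_closed : closed X)
  (Vf_ge0 : forall x, 0 <= Vf x) (Vf_continuous : continuous Vf)
  (Xf_sub : Xf `<=` X) (Xf_closed : closed Xf)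
  (hR : regularity f l X U)
  (hT : terminal_conditions N f l X U Vf Xf)
  (hS : open_loop_stability f U Vdelta)
  (lambda_gt0 : 0 < lambda) :
  (forall x, exists xbar (u : N.-tuple 'rV[R]_m),
     slack_minimizer f l X U Vf Xf Vdelta lambda x xbar u) /\
  forall (xbar_slack : 'rV[R]_n -> 'rV[R]_n)
         (u_slack : 'rV[R]_n -> N.-tuple 'rV[R]_m),
    (forall x, slack_minimizer f l X U Vf Xf Vdelta lambda
                 x (xbar_slack x) (u_slack x)) ->
    let pi_slack := fun x => (u_slack x)`_0 in
    let fcl := fun x w => f x (pi_slack x) + w in
    let V := Vslack N f l X U Vf Xf Vdelta lambda in
    [/\ ISS fcl, continuous V & ISS_Lyapunov fcl V].
Proof.
have [[al hal l_lb] f00 _ _ _ fc lc Uc] := hR.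
have [[kf [af [haf hkf]]] Xf0 XNc] := hT.
have [Vd0 Vdc [d1 [d2 [d3 [d4 [[hd1 hd2 hd3 hd4] Vdb Vdd]]]]]] := hS.
have kf_U x : Xf x -> U (kf x) by move=> /hkf[_ []].
have kf_Xf x : Xf x -> Xf (f x (kf x)) by move=> /hkf[].
have kf_decr x : Xf x -> Vf (f x (kf x)) <= Vf x - l x (kf x) by move=> /hkf[].
have X0 : Xf 0 by exact: interior_subset Xf0.
have Vf0 : Vf 0 <= 0.
  have [_ _ _] := hkf _ X0.
  by rewrite enorm0 (classK_0 (classKinfty_classK haf)).
have [u0 fu0 Ju0] := terminal_feasible N Xf_sub kf_U kf_Xf kf_decr X0.
have hmin := slack_minimizer_exists X_closed Uc fc lc lambda Xf_closed
  Vf_continuous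
  XNc Vdc (ex_intro _ 0 (ex_intro _ u0 fu0)).
split; first exact: hmin.
move=> xb us hus pi_slack fcl V.
have JN_lb z (u : N.-tuple 'rV[R]_m) : feasible f X U Xf z u ->
    al (enorm z) <= l z u`_0 <= JN f l Vf z u.
  move=> [hU _ _]; have zU : 0 <= enorm z by exact: enorm_ge0.
  apply/andP; split.
    apply: le_trans (l_lb _ _ (hU _ hN)).
    apply: (classK_le (classKinfty_classK hal)) => //.
    by rewrite lerDl enorm_ge0.
  rewrite /JN -(big_mkord xpredT (fun k => l (traj f u k z) u`_k)).
  rewrite big_ltn//= -addrA lerDl addr_ge0// big_nat sumr_ge0// => k.
  by move=> /andP[_ kN]; apply/l_ge0/hU.
have al0 (z : 'rV[R]_n) : 0 <= al (enorm z).
  by apply: (classK_ge0 (classKinfty_classK hal)); exact: enorm_ge0.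
have cost_ge0 x z (u : N.-tuple 'rV[R]_m) : feasible f X U Xf z u ->
    0 <= slack_cost f l Vf Vdelta lambda x z u.
  move=> /JN_lb/andP[h1 h2]; have := al0 z.
  have := mulr_ge0 (ltW lambda_gt0) (Vd0 x z); rewrite /slack_cost; lra.
have VE x : V x = slack_cost f l Vf Vdelta lambda x (xb x) (us x).
  exact: Vslack_minimizer.
have scaleK a : classKinfty a -> classKinfty (fun r => lambda * a r).
  by move=> ha; apply: (classKinfty_comp (classKinfty_scale lambda_gt0) ha).
have feasE x : feasible f X U Xf (xb x) (us x) by have [] := hus x.
have V_Lyap : ISS_Lyapunov fcl V.
  split; first by move=> x; rewrite VE cost_ge0.
  exists (fun r => Num.min (al (2^-1 * r)) (lambda * d1 (2^-1 * r))),
    (fun r => lambda * d2 r),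
    (fun r => Num.min (al (2^-1 * r)) (lambda * d3 (2^-1 * r))),
    (fun r => lambda * d4 r).
  have lK d : classKinfty d -> classK (fun r => lambda * d r).
    by move=> /scaleK/classKinfty_classK.
  have alK := classKinfty_classK hal.
  split.
  - split; [|exact: scaleK| |exact: scaleK].
      exact: (classKinfty_min_half hal (scaleK _ hd1)).
    exact: (classKinfty_min_half hal (scaleK _ hd3)).
  - move=> x; apply/andP; split.
      apply: (le_trans (min_half_le_add alK (lK _ hd1) x (xb x))).
      have /JN_lb/andP[h1 h2] := feasE x.
      have /andP[h3 _] := Vdb x (xb x).
      rewrite VE /slack_cost lerD//; first exact: le_trans h2.
      by rewrite ler_pM2l.
    (* The nominal state of the candidate is the origin. *)
    apply: (le_trans (Vslack_le cost_ge0 x fu0)).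
    have /andP[_ h] := Vdb x 0; rewrite subr0 in h.
    rewrite /slack_cost -[leRHS]add0r lerD ?ler_pM2l//.
    exact: le_trans Vf0.
  - move=> x w.
    have [v fv Jv] := shifted_feasible Xf_sub kf_U kf_Xf kf_decr hN (feasE x).
    have hV := Vslack_le cost_ge0 (fcl x w) fv.
    have [hU _ _] := feasE x.
    (* Real and nominal states evolve under the same first input. *)
    have hd := Vdd x (xb x) w _ (hU _ hN).
    have hm := min_half_le_add alK (lK _ hd3) x (xb x).
    have /JN_lb/andP[h1 _] := feasE x.
    rewrite -(ler_pM2l lambda_gt0) mulrBr mulrDr mulrN in hd.
    move: hV hm hd; rewrite (VE x) -/V /slack_cost /fcl /pi_slack /=; lra.
split => //; first exact: ISS_Lyapunov_ISS V_Lyap.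
exact: Vslack_continuous.
Qed.
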